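(* Let $\mathbb{K}\in\{\mathbb{R},\mathbb{C}\}$, let $\mathbf{A}\in\mathbb{K}^{M\times N}$ have columns $\mathbf{a}_1,\dots,\mathbf{a}_N\in\mathbb{K}^M$, let $\mathbf{B}_i\in\mathbb{K}^{m\times n_i}$ for $i=1,\dots,N$, and let $\mathbf{H}:\bigoplus_{i=1}^N\mathbb{K}^{n_i}\to\mathbb{K}^M\otimes\mathbb{K}^m$ be the hierarchical measurement operator $$\mathbf{H}(\mathbf{x}_1,\dots,\mathbf{x}_N)=\sum_{i=1}^N\mathbf{a}_i\otimes(\mathbf{B}_i\mathbf{x}_i).$$ Let $s$ and $\boldsymbol{\sigma}=(\sigma_1,\dots,\sigma_N)$ be hierarchical sparsity levels. Assume that $\mathbf{A}$ obeys the $s$-RIP with constant $\delta_s(\mathbf{A})$ and that each $\mathbf{B}_i$ obeys the $\sigma_i$-(Hi)RIP with constant $\delta_{\sigma_i}(\mathbf{B}_i)$. Then $\mathbf{H}$ obeys the $(s,\boldsymbol{\sigma})$-HiRIP with $$\delta_{(s,\boldsymbol{\sigma})}(\mathbf{H})\le\delta_s(\mathbf{A})+\sup_i\delta_{\sigma_i}(\mathbf{B}_i)+\delta_s(\mathbf{A})\cdot\sup_i\delta_{\sigma_i}(\mathbf{B}_i).$$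
   Context: All vector norms $\|\cdot\|$ are Euclidean ($\ell_2$); $\mathbb{K}^M\otimes\mathbb{K}^m\cong\mathbb{K}^{Mm}$ carries the Euclidean norm, so $\|\mathbf{a}\otimes\mathbf{b}\|=\|\mathbf{a}\|\|\mathbf{b}\|$. Sparsity: a vector is $s$-sparse ($s$ a positive integer) if it has at most $s$ nonzero entries. A block vector $\mathbf{x}=(\mathbf{x}_1,\dots,\mathbf{x}_N)\in\mathbb{K}^{n_1}\times\dots\times\mathbb{K}^{n_N}$ is $(s,\boldsymbol{\sigma})$-sparse if at most $s$ of the blocks $\mathbf{x}_i$ are nonzero and each nonzero block $\mathbf{x}_i$ is $\sigma_i$-sparse. Here $s$ is a positive integer and each $\sigma_i$ is a sparsity level on $\mathbb{K}^{n_i}$: either a positive integer (ordinary sparsity), or, recursively, a hierarchical sparsity level $(s',\boldsymbol{\sigma}')$ with respect to a given splitting of $\mathbb{K}^{n_i}$ into blocks (finitely many levels of nesting), with ''$\sigma_i$-sparse'' understood accordingly. RIP constants: for a matrix (linear map) $\mathbf{C}$ and a sparsity level $\tau$ on its domain (ordinary or hierarchical), $\delta_\tau(\mathbf{C})$ is the smallest $\delta\ge0$ such that $(1-\delta)\|\mathbf{x}\|^2\le\|\mathbf{C}\mathbf{x}\|^2\le(1+\delta)\|\mathbf{x}\|^2$ for all $\tau$-sparse $\mathbf{x}$. It is called the RIP constant for ordinary sparsity and the HiRIP constant for hierarchical sparsity. *)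

(* Defs.v *)
From HB Require Import structures.
From mathcomp Require Import all_boot all_order all_algebra.
From mathcomp Require Import classical_sets reals.
From mathcomp Require Import complex mxtens.

Set Implicit Arguments.
Unset Strict Implicit.
Unset Printing Implicit Defensive.

Import Order.TTheory GRing.Theory Num.Theory.

Local Open Scope classical_set_scope.
Local Open Scope ring_scope.
Local Open Scope complex_scope.

Variant scalar_kind := RealScalars | ComplexScalars.

Definition scalars (R : realType) (k : scalar_kind) : numFieldType :=
  match k with
  | RealScalars => R
  | ComplexScalars => R[i]
  end.

(* On R[i] the library norm takes its values in R[i] itself, with zero
   imaginary part; modulus is the same number as an element of R. *)
Definition modulus (R : realType) (k : scalar_kind) : scalars R k -> R :=
  match k return scalars R k -> R with
  | RealScalars => fun z : R => `|z|
  | ComplexScalars => fun z : R[i] => complex.Re `|z|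
  end.

Definition l2norm (R : realType) (k : scalar_kind) (n : nat)
    (x : 'cV[scalars R k]_n) : R :=
  Num.sqrt (\sum_(i < n) modulus (x i 0) ^+ 2).

(* Sparsity levels on K^n.  In Hier, K^n is split into consecutive blocks of
   sizes ns 0, ns 1, ...; the library's submxcol x i is the i-th block of x. *)
Inductive level : nat -> Type :=
| Plain (n s : nat) of (0 < s)%N : level n
| Hier (N : nat) (ns : 'I_N -> nat) (s : nat) of (0 < s)%N &
    (forall i : 'I_N, level (ns i)) : level (\sum_(i < N) ns i)%N.

Fixpoint sparse (K : numFieldType) (n : nat) (tau : level n) :
    'cV[K]_n -> Prop :=
  match tau in level n return 'cV[K]_n -> Prop with
  | @Plain n s _ => fun x => (#|[set i : 'I_n | x i 0%R != 0%R]%SET| <= s)%N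
  | @Hier N ns s _ sigma => fun x =>
      (#|[set i : 'I_N | submxcol x i != 0%R]%SET| <= s)%N /\
      forall i : 'I_N, submxcol x i != 0 -> sparse (sigma i) (submxcol x i)
  end.

Definition has_RIP (R : realType) (k : scalar_kind) (n p : nat)
    (C : 'cV[scalars R k]_n -> 'cV[scalars R k]_p) (tau : level n)
    (delta : R) : Prop :=
  0 <= delta /\
  forall x : 'cV[scalars R k]_n, sparse tau x ->
    (1 - delta) * l2norm x ^+ 2 <= l2norm (C x) ^+ 2 /\
    l2norm (C x) ^+ 2 <= (1 + delta) * l2norm x ^+ 2.

(* For linear C the set is nonempty, closed and bounded below, so that its
   infimum is its least element. *)
Definition RIP_const (R : realType) (k : scalar_kind) (n p : nat)
    (C : 'cV[scalars R k]_n -> 'cV[scalars R k]_p) (tau : level n) : R :=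
  inf [set delta : R | has_RIP C tau delta].

(* K^M (x) K^m is identified with K^(M m) by the Kronecker product *t; its
   number of columns 1 * 1 is convertible to 1. *)
Definition hier_measurement (K : numFieldType) (M m N : nat)
    (ns : 'I_N -> nat) (A : 'M[K]_(M, N)) (B : forall i : 'I_N, 'M[K]_(m, ns i))
    (x : 'cV[K]_(\sum_(i < N) ns i)) : 'cV[K]_(M * m) :=
  \sum_(i < N) (col i A *t (B i *m submxcol x i) : 'cV[K]_(M * m)).

(* Main.v *)
(* Reading H x one coordinate j of the second tensor factor at a time gives
   A applied to the s-sparse vector y_j of the j-th coordinates of the B_i x_i.
   Summing the RIP of A over j compares |H x|^2 with the sum over i of
   |B_i x_i|^2, which the RIPs of the B_i compare with |x|^2. *)
Require Import Defs.
From mathcomp Require Import all_boot all_order all_algebra.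
From mathcomp Require Import classical_sets reals.
From mathcomp Require Import complex mxtens lra.

Import Order.TTheory GRing.Theory Num.Theory.

Local Open Scope classical_set_scope.
Local Open Scope ring_scope.

Section HierarchicalRIP.
Set Implicit Arguments.
Unset Strict Implicit.
Unset Printing Implicit Defensive.

Context {R : realType} {k : scalar_kind}.
Local Notation K := (scalars R k).

Lemma modulus0 : modulus (0 : K) = 0.
Proof.
case: k; first exact: normr0.
have norm0 : `|0 : R[i]%C| = 0 by rewrite normr0.
by rewrite [LHS](congr1 (@complex.Re R) norm0).
Qed.

Lemma sqr_l2norm n (x : 'cV[K]_n) :
  l2norm x ^+ 2 = \sum_i modulus (x i 0) ^+ 2.
Proof. by rewrite sqr_sqrtr // sumr_ge0 // => i _; exact: sqr_ge0. Qed.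

Lemma l2norm0 n : l2norm (0 : 'cV[K]_n) = 0.
Proof.
by rewrite /l2norm big1 ?sqrtr0 // => i _; rewrite mxE modulus0 expr0n.
Qed.

Lemma sqr_l2norm_blocks {N} (ns : 'I_N -> nat)
    (x : 'cV[K]_(\sum_(i < N) ns i)) :
  l2norm x ^+ 2 = \sum_i l2norm (submxcol x i) ^+ 2.
Proof.
rewrite sqr_l2norm (eq_bigr _ (fun i _ => sqr_l2norm _)) sig_big_dep.
(* The flat indices of [x] correspond bijectively to pairs of a block and a position in it. *)
rewrite (reindex _ (@tagnat.sig_bij_on _ _)) /=.
by apply: eq_bigr => i _; rewrite mxE tagnat.sig2K.
Qed.

Lemma sqr_l2norm_tens M m (u : 'cV[K]_(M * m)) :
  l2norm u ^+ 2 =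
  \sum_j l2norm (\col_p u (mxtens_index (p, j)) 0) ^+ 2.
Proof.
rewrite sqr_l2norm (eq_bigr _ (fun j _ => sqr_l2norm _)) exchange_big /=.
rewrite pair_bigA (reindex (@mxtens_index M m)) /=; last first.
  by apply/onW_bij/Bijective; [exact: mxtens_indexK|exact: mxtens_unindexK].
by apply: eq_bigr => -[p j] _; rewrite mxE.
Qed.

(* Each sparse x imposes lower bounds on delta when l2norm x > 0, and a condition
   independent of delta when l2norm x = 0; both pass to the infimum. *)
Lemma RIP_const_attained n p (C : 'cV[K]_n -> 'cV[K]_p) (tau : level n)
    (delta : R) :
  has_RIP C tau delta -> has_RIP C tau (RIP_const C tau).
Proof.
move=> hd; set S := [set d | has_RIP C tau d].
have S0 : S !=set0 by exists delta.
split; first by apply: lb_le_inf => // d [].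
move=> x sx; have [_ /(_ x sx) [lo up]] := hd.
have [x0|x0] := eqVneq (l2norm x ^+ 2) 0.
  by move: lo up; rewrite x0 !mulr0.
have xp : 0 < l2norm x ^+ 2 by rewrite lt_def x0 sqr_ge0.
split.
- rewrite -ler_pdivlMr // lerBlDr -lerBlDl.
  apply: lb_le_inf => // d [_ /(_ x sx)[+ _]].
  by rewrite -ler_pdivlMr // lerBlDr -lerBlDl.
- rewrite -ler_pdivrMr // -lerBlDl.
  apply: lb_le_inf => // d [_ /(_ x sx)[_ +]].
  by rewrite -ler_pdivrMr // -lerBlDl.
Qed.

(** The admissible constants are bounded below by 0, so their infimum lies below each of them. *)
Lemma RIP_const_le n p (C : 'cV[K]_n -> 'cV[K]_p) (tau : level n) (delta : R) :
  has_RIP C tau delta -> RIP_const C tau <= delta.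
Proof. by move=> h; apply: ge_inf => //; exists 0 => d []. Qed.

(** Serves to replace the separate constants of the [B i] by their common supremum. *)
Lemma has_RIP_weaken n p (C : 'cV[K]_n -> 'cV[K]_p) (tau : level n) (d e : R) :
  d <= e -> has_RIP C tau d -> has_RIP C tau e.
Proof.
move=> de [d0 h]; split; first exact: le_trans de.
move=> x /h [lo up]; split.
- by apply: le_trans lo; rewrite ler_wpM2r ?sqr_ge0 // lerB.
- by apply: (le_trans up); rewrite ler_wpM2r ?sqr_ge0 // lerD.
Qed.

Section Measurement.
Context {M m N : nat} {ns : 'I_N -> nat}.
Variables (A : 'M[K]_(M, N)) (B : forall i, 'M[K]_(m, ns i)).

(** Entry [(p, j)] of the sum of the tensors is the sum over [i] of [A p i] times entry [j] of
    [B i *m submxcol x i], which is entry [p] of a product with [A]. *)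
Lemma sqr_l2norm_hier_measurement (x : 'cV[K]_(\sum_(i < N) ns i)) :
  l2norm (hier_measurement A B x) ^+ 2 =
  \sum_j l2norm (A *m \col_i (B i *m submxcol x i) j 0) ^+ 2.
Proof.
rewrite sqr_l2norm_tens; apply: eq_bigr => j _; congr (l2norm _ ^+ 2).
apply/colP => p; rewrite !mxE summxE; apply: eq_bigr => i _.
by rewrite [LHS]mxE mxtens_indexK /= [in RHS]mxE !ord1 [col i A _ _]mxE.
Qed.

(** A zero block of [x] has zero image under [B i], so the support stays within the set of nonzero
    blocks. *)
Lemma sparse_coordinates (s : nat) (s_gt0 : (0 < s)%N)
    (sigma : forall i, level (ns i)) x (j : 'I_m) :
  sparse (Hier s_gt0 sigma) x ->
  sparse (Plain N s_gt0) (\col_i (B i *m submxcol x i) j 0 : 'cV[K]_N).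
Proof.
move=> [xs _]; apply: leq_trans xs; apply/subset_leq_card/fintype.subsetP => i.
by rewrite !inE mxE; apply: contra_neq => ->; rewrite mulmx0 mxE.
Qed.

(** The constant is [(1 + a) * (1 + b) - 1], from chaining the two upper bounds. For [N = 0] the
    assumption on the [B i] is vacuous, so [0 <= b] is stated separately. *)
Lemma has_RIP_hier_measurement (s : nat) (s_gt0 : (0 < s)%N)
    (sigma : forall i, level (ns i)) (a b : R) :
  0 <= b ->
  has_RIP (mulmx A) (Plain N s_gt0) a ->
  (forall i, has_RIP (mulmx (B i)) (sigma i) b) ->
  has_RIP (hier_measurement A B) (Hier s_gt0 sigma) (a + b + a * b).
Proof.
move=> b0 [a0 hA] hB.
split=> [|x sx]; first by rewrite !addr_ge0 ?mulr_ge0.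
rewrite sqr_l2norm_hier_measurement sqr_l2norm_blocks.
set X := \sum_j _; set Y := \sum_j _.
pose Z := \sum_i l2norm (B i *m submxcol x i) ^+ 2.
have ZE : Z = \sum_j l2norm (\col_i (B i *m submxcol x i) j 0 : 'cV[K]_N) ^+ 2.
  rewrite /Z (eq_bigr _ (fun i _ => sqr_l2norm _)) exchange_big /=.
  apply: eq_bigr => j _; rewrite sqr_l2norm.
  by apply: eq_bigr => i _; rewrite [in RHS]mxE.
have [YloA YupA] : (1 - a) * Z <= Y /\ Y <= (1 + a) * Z.
  rewrite ZE !mulr_sumr; split; apply: ler_sum => j _.
    by have [] := hA _ (sparse_coordinates j sx).
  by have [] := hA _ (sparse_coordinates j sx).
have hBx i : (1 - b) * l2norm (submxcol x i) ^+ 2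
      <= l2norm (B i *m submxcol x i) ^+ 2 /\
    l2norm (B i *m submxcol x i) ^+ 2
      <= (1 + b) * l2norm (submxcol x i) ^+ 2.
  (* Sparsity at level [sigma i] is known for nonzero blocks only; for a zero block all terms
     vanish. *)
  have [->|xi] := eqVneq (submxcol x i) 0.
    by rewrite mulmx0 !l2norm0 expr0n /= !mulr0.
  by have [_] := hB i; apply; case: sx => _; exact.
have [Zlo Zup] : (1 - b) * X <= Z /\ Z <= (1 + b) * X.
  by rewrite /X /Z !mulr_sumr; split; apply: ler_sum => i _; have [] := hBx i.
have X0 : 0 <= X by apply: sumr_ge0 => i _; exact: sqr_ge0.
have Y0 : 0 <= Y by apply: sumr_ge0 => j _; exact: sqr_ge0.
(* These products are atoms for [lra], which needs their signs. *)
have aX := mulr_ge0 a0 X0; have abX := mulr_ge0 b0 aX.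
have bX := mulr_ge0 b0 X0.
split; last first.
  apply: (le_trans YupA).
  suff : (1 + a) * Z <= (1 + a) * ((1 + b) * X) by lra.
  by rewrite ler_wpM2l //; lra.
(* If 1 < a, the claimed lower bound is nonpositive. *)
have [a1|a1] := leP a 1.
  apply: le_trans YloA.
  (* Here [(1 - a) * (1 - b)] exceeds [1 - (a + b + a * b)] by [2 * a * b], which is nonnegative. *)
  suff : (1 - a) * ((1 - b) * X) <= (1 - a) * Z by lra.
  by rewrite ler_wpM2l //; lra.
apply: le_trans Y0.
suff : 0 <= (a - 1) * X by lra.
by rewrite mulr_ge0 //; lra.
Qed.

End Measurement.
End HierarchicalRIP.

Theorem theorem2p1 (R : realType) (k : scalar_kind) (M m N : nat)
    (ns : 'I_N -> nat)
    (A : 'M[scalars R k]_(M, N))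
    (B : forall i : 'I_N, 'M[scalars R k]_(m, ns i))
    (s : nat) (s_gt0 : (0 < s)%N)
    (sigma : forall i : 'I_N, level (ns i)) :
  let H := hier_measurement A B in
  let deltaA := RIP_const (mulmx A) (Plain N s_gt0) in
  let deltaB := fun i : 'I_N => RIP_const (mulmx (B i)) (sigma i) in
  let deltaH := RIP_const H (Hier s_gt0 sigma) in
  has_RIP (mulmx A) (Plain N s_gt0) deltaA ->
  (forall i : 'I_N, has_RIP (mulmx (B i)) (sigma i) (deltaB i)) ->
  has_RIP H (Hier s_gt0 sigma) deltaH /\
  deltaH <= deltaA + sup (range deltaB) + deltaA * sup (range deltaB).
Proof.
move=> H deltaA deltaB deltaH hA hB.
have deltaB_ge0 i : 0 <= deltaB i by case: (hB i).
have le_sup i : deltaB i <= sup (range deltaB).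
  apply: ub_le_sup; last by exists i.
  (* A finite sum of nonnegative terms dominates each term. *)
  exists (\sum_j deltaB j) => _ [j _ <-].
  by rewrite (bigD1 j) //= lerDl sumr_ge0.
have sup_ge0 : 0 <= sup (range deltaB).
  (* Without blocks the range is empty and its [sup] is 0 by convention. *)
  have [->|/set0P[_ [i _ _]]] := eqVneq (range deltaB) set0.
    by rewrite sup0.
  exact: le_trans (le_sup i).
have hH := has_RIP_hier_measurement sup_ge0 hA
  (fun i => has_RIP_weaken (le_sup i) (hB i)).
(* The constant in [hH] both shows that admissible constants exist and bounds their infimum. *)
by split; [exact: RIP_const_attained hH|exact: RIP_const_le].
Qed.
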